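(* Let $M$ be a diffuse von Neumann algebra acting on a separable complex Hilbert space. Then its unitary group $U_M$ is minimally almost periodic, i.e. the only continuous, finite-dimensional, irreducible, unitary representation of $U_M$ is the (one-dimensional) trivial representation.
   Context: $U_M$ denotes the group of unitary elements of $M$, a topological group for the weak operator topology (which coincides on $U_M$ with the strong, ultraweak and ultrastrong topologies). A (non-zero) projection $e\in M$ is an atom if $eMe=\mathbb{C}e$; $M$ is diffuse if it contains no atoms. *)

(* Defs.v *)
From HB Require Import structures.
From mathcomp Require Import all_boot all_order all_algebra.
From mathcomp Require Import sesquilinear spectral complex.
From mathcomp Require Import all_classical all_reals all_analysis.

Set Implicit Arguments.
Unset Strict Implicit.
Unset Printing Implicit Defensive.

Import Order.TTheory GRing.Theory Num.Theory.
Import numFieldNormedType.Exports.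

Local Open Scope classical_set_scope.
Local Open Scope ring_scope.

(* R[i] as a numClosedFieldType: the norm topology of numFieldNormedType is
   found on the structure, not on the bare type R[i]. *)
Definition Cplx (R : realType) : numClosedFieldType := complex R.

Section TopologicalGroups.
Variables (R : realType) (G : topologicalType).
Variables (mul : G -> G -> G) (one : G) (U : set G).

(* The group is (U, mul, one) with the topology induced by G; the values of a
   representation outside U are irrelevant. *)

Record unitary_representation (n : nat) (pi : G -> 'M[Cplx R]_n) : Prop := {
  rep_unitary : forall u, U u -> pi u \is unitarymx;
  rep_one : pi one = 1%:M;
  rep_mul : forall u v, U u -> U v -> pi (mul u v) = pi u *m pi v }.

Definition irreducible_representation (n : nat) (pi : G -> 'M[Cplx R]_n) :=
  (0 < n)%N /\
  forall W : {vspace 'cV[Cplx R]_n},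
    (forall u w, U u -> w \in W -> pi u *m w \in W) ->
    W = 0%VS \/ W = fullv.

Definition trivial_representation (n : nat) (pi : G -> 'M[Cplx R]_n) :=
  n = 1%N /\ forall u, U u -> pi u = 1%:M.

Definition minimally_almost_periodic :=
  forall (n : nat) (pi : G -> 'M[Cplx R]_n),
    unitary_representation pi ->
    {within U, continuous pi} ->
    irreducible_representation pi ->
    trivial_representation pi.

End TopologicalGroups.

Definition separable_space (T : topologicalType) :=
  exists2 D : set T, countable D & dense D.

Section VonNeumannAlgebras.
Variables (R : realType) (H : completeNormedModType (Cplx R)).
Variable dot : {dot H for @Num.conj (Cplx R)}.

Definition is_hilbert := forall x : H, dot x x = `|x| ^+ 2.

Definition bounded_operator (T : H -> H) := linear T /\ continuous T.

Definition is_adjoint (T S : H -> H) := forall x y, dot (T x) y = dot x (S y).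

Definition matrix_coefficients (T : H -> H) : {ptws (H * H) -> Cplx R} :=
  fun p => dot (T p.1) p.2.

(* The weak operator topology. The carrier is the type of all functions
   H -> H; only the topology induced on bounded operators is meaningful. *)
Definition wot := initial_topology matrix_coefficients.
HB.instance Definition _ := Topological.on wot.

Record von_neumann_algebra (M : set wot) : Prop := {
  vna_bounded : M `<=` bounded_operator;
  vna_id : M idfun;
  vna_add : forall S T, M S -> M T -> M (S \+ T);
  vna_scale : forall (a : Cplx R) T, M T -> M (fun x => a *: T x);
  vna_comp : forall S T, M S -> M T -> M (S \o T);
  vna_adjoint : forall T, M T -> exists2 S, M S & is_adjoint T S;
  vna_closed : closure M `&` bounded_operator `<=` M }.

Definition unitary_operator (u : H -> H) :=
  exists v, [/\ is_adjoint u v, v \o u = idfun & u \o v = idfun].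

Definition unitary_group (M : set wot) : set wot := M `&` unitary_operator.

Definition projection (e : H -> H) := e \o e = e /\ is_adjoint e e.

Definition atom (M : set wot) (e : H -> H) :=
  [/\ M e, projection e, e <> (fun=> 0) &
      [set e \o x \o e | x in M] =
        [set (fun x => a *: e x) | a in [set: Cplx R]]].

Definition diffuse (M : set wot) := forall e, ~ atom M e.

End VonNeumannAlgebras.

(* Main.v *)
Require Import Defs.
From HB Require Import structures.
From mathcomp Require Import all_boot all_order all_algebra.
From mathcomp Require Import sesquilinear spectral complex.
From mathcomp Require Import all_classical all_reals all_analysis.
From mathcomp Require Import ring lra.

Set Implicit Arguments.
Unset Strict Implicit.
Unset Printing Implicit Defensive.

Import Order.TTheory GRing.Theory Num.Theory.
Import numFieldNormedType.Exports.

Local Open Scope classical_set_scope.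
Local Open Scope ring_scope.

(** Why unitary groups of diffuse algebras have no finite-dimensional
    representations.  Let [pi] be continuous and let [u] be a unitary of [M].
    For a projection [e] of [M] commuting with [u], let [localize u e] be the
    unitary acting as [u] on the range of [e] and as the identity on its
    orthogonal; then [u = localize u 1], and [localize u] turns orthogonal sums
    of projections into products ([localize_sub]).

    - Small pieces are invisible.  A weak operator neighbourhood of the identity
      only tests finitely many vectors, so if [p] nearly kills those vectors,
      every unitary supported on [p], in particular every power of
      [localize u p], lies in that neighbourhood.  Matrix groups have no small
      subgroups, hence [pi (localize u p) = 1] ([small_projection_trivial]).

    - Visible pieces have a minimal one.  Suppose [pi u <> 1] and call [e]
      visible when [pi (localize u e) <> 1].  Decreasing chains of projections
      of [M] converge strongly inside [M] ([chain_limit]); by the first point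
      the limit of a chain of visible projections is visible.  Zorn's lemma
      gives a minimal visible [e].  If [f] is a projection below [e] commuting
      with [u], one of [f], [e - f] is visible, so [f] is [0] or [e].

    - Such an [e] is an atom.  A self-adjoint [a] commuting with [e] and [u] has
      spectral projections commuting with [e] and [u]; they restrict to [0] or
      [1] on the range of [e], so [a] is a real scalar there
      ([minimal_scalar]).  Applied to the real and imaginary parts of [u], this
      makes [u] scalar on the range of [e]; then [u] commutes with [e x e] for
      every [x] in [M], and the same argument gives [e M e = C e]
      ([minimal_atom]).  A diffuse algebra has no atoms, so [pi] is trivial on
      the whole unitary group, and an irreducible trivial action has
      dimension one.

    The spectral projections needed here ([spectral_projection]) come from
    Zorn's lemma as well, as minimal elements of suitable sets of positive
    operators in the bicommutant: first the positive part of [b] as a minimal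
    majorant of [0] and [b], then the support projection of that part as a
    minimal operator between [0] and [1] fixing its range.

    All estimates use the real inner product [ip x y = Re (dot x y)], which
    turns inequalities between operators into inequalities between reals. *)

(** * Real and complex numbers *)

(** For [c > 0] evaluate at the vertex [- b / c]; a polynomial with [c < 0], or
    with [c = 0] and [b != 0], takes negative values. *)
Lemma quadratic_disc (R : realType) (a b c : R) :
  (forall t, 0 <= a + 2 * b * t + c * t ^+ 2) -> b ^+ 2 <= a * c.
Proof.
move=> h; have a0 : 0 <= a by have := h 0; rewrite expr0n /= !mulr0 !addr0.
have [c0|c0|c0] := ltgtP c 0.
- have := h ((a + 1 + 2 * `|b|) / - c + 1).
  set t := _ / _ + 1 => ht.
  have t1 : 1 <= t.
    by rewrite /t lerDr divr_ge0 ?oppr_ge0 ?(ltW c0)// !addr_ge0 // mulr_ge0.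
  have e : - c * (t - 1) = a + 1 + 2 * `|b|.
    by rewrite /t addrK mulrC divfK // oppr_eq0 lt_eqF.
  have bb : b <= `|b| by exact: ler_norm.
  have b0 : 0 <= `|b| by [].
  nra.
- have := h (- b / c).
  have -> : a + 2 * b * (- b / c) + c * (- b / c) ^+ 2 = (a * c - b ^+ 2) / c.
    by field; rewrite gt_eqF.
  by rewrite pmulr_lge0 ?invr_gt0 // subr_ge0.
- have [->|b0] := eqVneq b 0; first by rewrite expr0n /= c0 mulr0.
  have := h (- (a + 1) / (2 * b)); rewrite c0 mul0r addr0.
  have -> : 2 * b * (- (a + 1) / (2 * b)) = - (a + 1) by field.
  lra.
Qed.

Section ComplexParts.
Variable R : realType.
Implicit Types (a b : Cplx R).

Lemma complex_eta a : a = Complex (complex.Re a) (complex.Im a).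
Proof. by case: a. Qed.

Lemma ReD a b : complex.Re (a + b) = complex.Re a + complex.Re b.
Proof. by case: a b => [? ?] [? ?]. Qed.

Lemma ReN a : complex.Re (- a) = - complex.Re a.
Proof. by case: a. Qed.

Lemma ReZ (t : R) a : complex.Re ((t%:C%C : Cplx R) * a) = t * complex.Re a.
Proof. by case: a => x y /=; rewrite mul0r subr0. Qed.

Lemma Re_conj a : complex.Re (Num.conj a) = complex.Re a.
Proof. by case: a. Qed.

Lemma Im_conj a : complex.Im (Num.conj a) = - complex.Im a.
Proof. by case: a. Qed.

Lemma Rei a : complex.Re (('i%C : Cplx R) * a) = - complex.Im a.
Proof. by case: a => x y /=; rewrite mul0r sub0r mul1r. Qed.

Lemma gt0_realC (e : Cplx R) : 0 < e -> exists2 r : R, 0 < r & e = r%:C%C.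
Proof.
case: e => a b; rewrite ltcE /= => /andP[/eqP -> a0].
by exists a.
Qed.

End ComplexParts.

(** * Matrix groups have no small subgroups *)

Section NoSmallSubgroups.
Variables (R : realType) (n : nat).
Implicit Types (A B : 'M[Cplx R]_n).

Definition absr (z : Cplx R) : R := complex.Re `|z|.

Lemma absrE (z : Cplx R) : `|z| = (absr z)%:C%C :> Cplx R.
Proof.
have : 0 <= `|z| by [].
rewrite /absr; case: `|z| => a b; rewrite lecE /= => /andP[/eqP -> _].
by [].
Qed.

Lemma absr_ge0 z : 0 <= absr z.
Proof. by rewrite -(@ler0c R) -absrE. Qed.

Lemma absrD x y : absr (x + y) <= absr x + absr y.
Proof. by rewrite -(@lecR R) rmorphD /= -!absrE ler_normD. Qed.

Lemma absrM x y : absr (x * y) = absr x * absr y.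
Proof. by apply: (@complexI R); rewrite rmorphM /= -!absrE normrM. Qed.

Lemma absr_eq0 z : absr z = 0 -> z = 0.
Proof. by move=> h; apply/normr0_eq0; rewrite absrE h. Qed.

Lemma absr_sum (I : finType) (F : I -> Cplx R) :
  absr (\sum_i F i) <= \sum_i absr (F i).
Proof.
elim/big_ind2: _ => //; first by rewrite /absr normr0.
by move=> x a y b xa yb; apply: le_trans (absrD _ _) (lerD _ _).
Qed.

(** The entrywise l1 norm: unlike the maximum norm, it is submultiplicative
    without a dimension factor. *)
Definition mxsum A : R := \sum_i \sum_j absr (A i j).

Lemma mxsum_ge0 A : 0 <= mxsum A.
Proof. by do 2 apply: sumr_ge0 => ? _; exact: absr_ge0. Qed.

Lemma mxsumD A B : mxsum (A + B) <= mxsum A + mxsum B.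
Proof.
rewrite -big_split; apply: ler_sum => i _; rewrite -big_split.
by apply: ler_sum => j _; rewrite mxE absrD.
Qed.

Lemma mxsumM A B : mxsum (A *m B) <= mxsum A * mxsum B.
Proof.
rewrite /mxsum mulr_suml; apply: ler_sum => i _.
apply: (@le_trans _ _ (\sum_j \sum_k absr (A i k) * absr (B k j))).
  apply: ler_sum => j _; rewrite mxE; apply: le_trans (absr_sum _) _.
  by apply: ler_sum => k _; rewrite absrM.
rewrite exchange_big mulr_suml /=; apply: ler_sum => k _.
rewrite -mulr_sumr ler_wpM2l ?absr_ge0 // [leRHS](bigD1 k) //= lerDl.
by do 2 apply: sumr_ge0 => ? _; exact: absr_ge0.
Qed.

Lemma mxsum_eq0 A : mxsum A = 0 -> A = 0.
Proof.
move=> /eqP; rewrite psumr_eq0 => [|i _]; last first.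
  by apply: sumr_ge0 => ? _; exact: absr_ge0.
move=> /allP h; apply/matrixP => i j; rewrite mxE; apply: absr_eq0.
have := h i (mem_index_enum i).
rewrite psumr_eq0 => [|k _]; last exact: absr_ge0.
by move=> /allP /(_ j (mem_index_enum j)) /eqP.
Qed.

(** Squaring pushes a matrix near [1] away from [1]: with [B = A - 1] one has
    [A ^ 2 - 1 = 2 B + B ^ 2], whose norm is at least [(2 - |B|) |B|]. *)
Lemma mxsum_sqr A : mxsum (A - 1%:M) <= 2^-1 ->
  3 / 2 * mxsum (A - 1%:M) <= mxsum (A *m A - 1%:M).
Proof.
move: (A - _) (subrK 1%:M A) => B <- hB.
have -> : (B + 1%:M) *m (B + 1%:M) - 1%:M = B + B + B *m B.
  by rewrite mulmxDl !mulmxDr !mulmx1 !mul1mx !addrA addrK [RHS]addrC addrA.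
set C := B + B + _.
have : mxsum (B + B) <= mxsum C + mxsum B * mxsum B.
  have -> : B + B = C + - (B *m B) by rewrite addrK.
  apply: le_trans (mxsumD _ _) _; rewrite lerD2l.
  apply: le_trans (mxsumM _ _); rewrite le_eqVlt; apply/orP; left; apply/eqP.
  by apply: eq_bigr => i _; apply: eq_bigr => j _; rewrite mxE /absr normrN.
have -> : mxsum (B + B) = 2 * mxsum B.
  rewrite mulr_sumr; apply: eq_bigr => i _; rewrite mulr_sumr.
  apply: eq_bigr => j _.
  by rewrite mxE /absr -mulr2n normrMn mulr2n ReD -mulr2n mulr_natl.
have := mxsum_ge0 B; set b := mxsum B => b0.
have : b * b <= b * 2^-1 by rewrite ler_wpM2l.
lra.
Qed.

Lemma mxsum_near1 (e : R) A : (0 <= e) ->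
  (forall i j, absr (A i j) <= e) -> mxsum A <= n%:R * (n%:R * e).
Proof.
move=> e0 h; apply: (@le_trans _ _ (\sum_(i < n) \sum_(j < n) e)).
  by do 2 apply: ler_sum => ? _.
by rewrite !sumr_const !card_ord -[e *+ n]mulr_natl -[leLHS]mulr_natl.
Qed.

End NoSmallSubgroups.

Lemma geometric_bounded0 (R : realType) (x c : R) : 0 <= x ->
  (forall m, (3 / 2) ^+ m * x <= c) -> x = 0.
Proof.
move=> x0 h; apply/eqP; rewrite eq_le x0 andbT leNgt; apply/negP => xp.
have bern m : 1 + m%:R / 2 <= (3 / 2 : R) ^+ m.
  elim: m => [|m IH]; first by rewrite mul0r addr0 expr0.
  rewrite exprS -natr1; have m0 : 0 <= m%:R :> R by [].
  lra.
have cx : 0 <= c / x.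
  rewrite divr_ge0 // ?(ltW xp) //.
  by apply: le_trans (h 0); rewrite expr0 mul1r.
have := truncnS_gt (2 * (c / x)).
set m := (Num.truncn _).+1 => hm.
have := h m; rewrite -ler_pdivlMr // => /(le_trans (bern m)); lra.
Qed.

(** * The real inner product of a complex Hilbert space *)

Section InnerProduct.
Variables (R : realType) (H : completeNormedModType (Cplx R)).
Variable dot : {dot H for @Num.conj (Cplx R)}.
Hypothesis Hhilb : is_hilbert dot.

Definition ip (x y : H) : R := complex.Re (dot x y).

Definition rscale (t : R) (x : H) : H := (t%:C%C : Cplx R) *: x.
Local Notation "t *:r x" := (rscale t x) (at level 40).

Lemma rscaleDr t x y : t *:r (x + y) = t *:r x + t *:r y.
Proof. exact: scalerDr. Qed.

Lemma rscaleDl s t x : (s + t) *:r x = s *:r x + t *:r x.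
Proof. by rewrite /rscale rmorphD scalerDl. Qed.

Lemma rscale1 x : 1 *:r x = x.
Proof. by rewrite /rscale rmorph1 scale1r. Qed.

Lemma ipDl x y z : ip (x + y) z = ip x z + ip y z.
Proof. by rewrite /ip linearDl ReD. Qed.

Lemma ipNl x z : ip (- x) z = - ip x z.
Proof. by rewrite /ip linearNl ReN. Qed.

Lemma ipC x y : ip x y = ip y x.
Proof.
rewrite /ip (@hermitian_subproof _ _ _ _ dot x y) expr0 mul1r.
exact: Re_conj.
Qed.

Lemma ipDr x y z : ip z (x + y) = ip z x + ip z y.
Proof. by rewrite ![ip z _]ipC ipDl. Qed.

Lemma ipNr x z : ip z (- x) = - ip z x.
Proof. by rewrite ![ip z _]ipC ipNl. Qed.

Lemma ipBl x y z : ip (x - y) z = ip x z - ip y z.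
Proof. by rewrite ipDl ipNl. Qed.

Lemma ipBr x y z : ip z (x - y) = ip z x - ip z y.
Proof. by rewrite ipDr ipNr. Qed.

Lemma ipZl t x z : ip (t *:r x) z = t * ip x z.
Proof. by rewrite /ip /rscale linearZl_LR ReZ. Qed.

Lemma ipZr t x z : ip z (t *:r x) = t * ip z x.
Proof. by rewrite ![ip z _]ipC ipZl. Qed.

Lemma ip0l x : ip 0 x = 0.
Proof. by rewrite -[0](subrr x) ipBl subrr. Qed.

Lemma ip_norm x : `|x| ^+ 2 = (ip x x)%:C%C :> Cplx R.
Proof.
rewrite -Hhilb /ip; have : 0 <= dot x x by rewrite Hhilb exprn_ge0.
rewrite [dot x x in X in X -> _]complex_eta lecE => /andP[/= /eqP e _].
by rewrite [LHS]complex_eta e.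
Qed.

Lemma ip_ge0 x : 0 <= ip x x.
Proof. by rewrite -(@ler0c R) -ip_norm exprn_ge0. Qed.

Lemma ip_eq0 x : ip x x = 0 -> x = 0.
Proof.
move=> h; have : `|x| ^+ 2 == 0 by rewrite ip_norm h rmorph0.
by rewrite expf_eq0 /= normr_eq0 => /eqP.
Qed.

Lemma normlt_ip (x : H) (r : R) : 0 < r ->
  (`|x| < (r%:C%C : Cplx R)) = (ip x x < r ^+ 2).
Proof.
move=> r0; rewrite -(@ltr_pXn2r _ 2) ?nnegrE ?ler0c ?(ltW r0) //.
by rewrite ip_norm -rmorphXn ltcR.
Qed.

(** The real inner product determines the complex one: the imaginary part is
    recovered by rotating one argument. *)
Lemma dot_ip x y : dot x y = Complex (ip x y) (- ip (('i%C : Cplx R) *: x) y).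
Proof.
by rewrite /ip linearZl_LR Rei opprK; exact: complex_eta.
Qed.

(** * Positive operators *)

(** Operators are bare functions with a linearity hypothesis; these lemmas make
    that hypothesis usable by rewriting. *)
Lemma linD (T : H -> H) x y : linear T -> T (x + y) = T x + T y.
Proof. by move=> l; have := l 1 x y; rewrite !scale1r. Qed.

Lemma lin0 (T : H -> H) : linear T -> T 0 = 0.
Proof.
by move=> l; have := l (-1) 0 0; rewrite !scaleN1r oppr0 addr0 addNr.
Qed.

Lemma linZ (T : H -> H) (a : Cplx R) x : linear T -> T (a *: x) = a *: T x.
Proof. by move=> l; have := l a x 0; rewrite (lin0 l) !addr0. Qed.

Lemma linZr (T : H -> H) (t : R) x : linear T -> T (t *:r x) = t *:r T x.
Proof. exact: linZ. Qed.

Lemma linN (T : H -> H) x : linear T -> T (- x) = - T x.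
Proof. by move=> l; rewrite -scaleN1r linZ // scaleN1r. Qed.

Lemma linB (T : H -> H) x y : linear T -> T (x - y) = T x - T y.
Proof. by move=> l; rewrite linD // linN. Qed.

Definition selfadjoint (T : H -> H) := forall x y, ip (T x) y = ip x (T y).
Definition le_op (S T : H -> H) := forall x, ip (S x) x <= ip (T x) x.
Definition positive (T : H -> H) :=
  [/\ linear T, selfadjoint T & forall x, 0 <= ip (T x) x].

(** Complex linearity upgrades real self-adjointness to the complex one. *)
Lemma selfadjointP T : linear T -> selfadjoint T <-> is_adjoint dot T T.
Proof.
move=> l; split=> [s x y|s x y]; last by rewrite /ip s.
by rewrite !dot_ip -linZ // !s.
Qed.

(** Cauchy-Schwarz for the semi-definite form [ip (D _) _]. *)
Lemma pos_CS D v w : positive D ->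
  ip (D v) w ^+ 2 <= ip (D v) v * ip (D w) w.
Proof.
move=> [l s p]; apply: quadratic_disc => t.
have := p (v + t *:r w).
rewrite linD // linZr // !(ipDl, ipDr, ipZl, ipZr).
have -> : ip (D w) v = ip (D v) w by rewrite s ipC.
by congr (0 <= _); ring.
Qed.

(** [D ^ 2 <= K D] for [0 <= D <= K]: Cauchy-Schwarz with [w = D v] gives
    [|D v| ^ 4 <= ip (D v) v * ip (D (D v)) (D v) <= ip (D v) v * K |D v| ^ 2].
    This replaces the square root of [D] in every estimate below. *)
Lemma pos_bound D (K : R) : positive D -> 0 <= K ->
  (forall w, ip (D w) w <= K * ip w w) ->
  forall v, ip (D v) (D v) <= K * ip (D v) v.
Proof.
move=> pD K0 hK v; have := pos_CS v (D v) pD.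
have := hK (D v); case: pD => _ _ p.
have := p v; have := p (D v); have := ip_ge0 (D v).
set a := ip (D v) (D v); set b := ip (D v) v; set c := ip (D (D v)) (D v).
move=> a0 c0 b0 caK cs.
have [->|an0] := eqVneq a 0; first by rewrite mulr_ge0.
have ap : 0 < a by rewrite lt_def an0.
rewrite -(ler_pM2r ap) -expr2; apply: (le_trans cs).
have -> : K * b * a = b * (K * a) by ring.
by rewrite ler_wpM2l.
Qed.

Lemma ip_CS v w : ip v w ^+ 2 <= ip v v * ip w w.
Proof. by apply: (@pos_CS idfun); split=> //; exact: ip_ge0. Qed.

Lemma pos0 D : positive D -> (forall v, ip (D v) v = 0) -> forall v, D v = 0.
Proof.
move=> pD h v; apply: ip_eq0; apply/eqP; rewrite eq_le ip_ge0 andbT.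
rewrite -[leRHS](mul0r (ip (D v) v)).
by apply: (pos_bound pD) => // w; rewrite h mul0r.
Qed.

Lemma le_op_anti S T : linear S -> linear T -> selfadjoint S -> selfadjoint T ->
  le_op S T -> le_op T S -> S = T.
Proof.
move=> lS lT sS sT ST TS; apply/funext => v; apply/eqP; rewrite -subr_eq0.
apply/eqP; apply: (@pos0 (fun v => S v - T v)) => [|w].
  split=> [a x y|x y|x]; last by rewrite ipBl subr_ge0.
    by rewrite lS lT scalerBr opprD addrACA.
  by rewrite ipBl ipBr sS sT.
by apply/eqP; rewrite ipBl subr_eq0 eq_le ST TS.
Qed.

Lemma bounded_operatorP T : linear T -> (bounded_operator T <->
  exists2 K : R, 0 <= K & forall v, ip (T v) (T v) <= K ^+ 2 * ip v v).
Proof.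
move=> l.
pose T' : {linear H -> H} := HB.pack T (GRing.isLinear.Build _ _ _ _ T l).
split=> [[_ c]|[K K0 hK]].
  have /linear_boundedP/pinfty_ex_gt0[K K0 hK] : bounded_near T' (nbhs 0).
    by apply/linear_bounded_continuous.
  have [k k0 Kk] := gt0_realC K0; exists k; first exact: ltW.
  move=> v; have : `|T v| ^+ 2 <= ((k%:C%C : Cplx R) * `|v|) ^+ 2.
    by rewrite ler_pXn2r ?nnegrE ?mulr_ge0 ?ler0c ?(ltW k0)// -Kk; exact: hK.
  by rewrite exprMn !ip_norm -rmorphXn -rmorphM lecR.
split=> //; apply: (@bounded_linear_continuous _ _ _ T').
apply/linear_boundedP; near=> r => x.
have Kr : (K%:C%C : Cplx R) <= r.
  by near: r; apply: nbhs_pinfty_ge; rewrite ger0_real // ler0c.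
apply: (le_trans _ (ler_wpM2r _ Kr)) => //.
rewrite -(@ler_pXn2r _ 2) ?nnegrE ?mulr_ge0 ?ler0c //.
by rewrite exprMn !ip_norm -rmorphXn -rmorphM lecR.
Unshelve. all: by end_near. Qed.


(** * Strong and weak operator convergence *)

Lemma cvg_ipP (T : Type) (F : set_system T) {FF : Filter F} (f : T -> H) x :
  f @ F --> x <->
  forall e : R, 0 < e -> \forall t \near F, ip (x - f t) (x - f t) < e.
Proof.
rewrite cvgrPdist_lt; split=> [h e e0|h _ /gt0_realC[e e0 ->]].
  have se : 0 < Num.sqrt e by rewrite sqrtr_gt0.
  have := h (Num.sqrt e)%:C%C; rewrite ltcR => /(_ se).
  apply: filterS => t; rewrite normlt_ip // sqr_sqrtr //; exact: ltW.
have e2 : 0 < e ^+ 2 by rewrite exprn_gt0.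
by apply: filterS (h _ e2) => t; rewrite normlt_ip.
Qed.

Lemma cvg_ip (T : Type) (F : set_system T) {FF : Filter F} (f : T -> H) x y :
  f @ F --> x -> (fun t => ip (f t) y) @ F --> ip x y.
Proof.
move=> /cvg_ipP h; apply/cvgrPdist_lt => e e0.
have y0 : 0 < 1 + ip y y by rewrite ltr_wpDr // ip_ge0.
have : 0 < e ^+ 2 / (1 + ip y y) by rewrite divr_gt0 // exprn_gt0.
move=> /h; apply: filterS => t; rewrite ltr_pdivlMr // => hd.
rewrite -ipBl -(@ltr_pXn2r _ 2) ?nnegrE ?(ltW e0) //.
rewrite real_normK ?num_real //; apply: le_lt_trans (ip_CS _ _) _.
by apply: le_lt_trans hd; rewrite ler_wpM2l ?ip_ge0 // lerDr.
Qed.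

Lemma cvg_eq (T : Type) (F : set_system T) {FF : ProperFilter F}
    (f g : T -> H) (x y : H) :
  (\forall t \near F, f t = g t) -> f @ F --> x -> g @ F --> y -> x = y.
Proof.
move=> fg fx gy; apply: (cvg_unique (@norm_hausdorff _ H) fx).
by apply: cvg_trans gy; apply: near_eq_cvg; apply: filterS fg.
Qed.

(** The complex Cauchy-Schwarz inequality, from the real one applied to
    [z = conj (dot x y) *: x], for which [dot z y = |dot x y| ^ 2] is real. *)
Lemma norm_dot x y : `|dot x y| <= `|x| * `|y|.
Proof.
have [->|d0] := eqVneq (dot x y) 0; first by rewrite normr0 mulr_ge0.
have dp : 0 < `|dot x y| by rewrite normr_gt0.
pose z := Num.conj (dot x y) *: x.
have zy : (ip z y)%:C%C = `|dot x y| ^+ 2 :> Cplx R.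
  have e : dot z y = `|dot x y| ^+ 2 by rewrite linearZl_LR normCKC.
  have : 0 <= dot z y by rewrite e exprn_ge0.
  rewrite [dot z y]complex_eta lecE => /andP[/= /eqP im _].
  by rewrite /ip -e [RHS]complex_eta im.
have : (ip z y)%:C%C ^+ 2 <= (ip z z)%:C%C * (ip y y)%:C%C :> Cplx R.
  by rewrite -rmorphXn -rmorphM lecR ip_CS.
rewrite -!ip_norm zy normrZ norm_conjC -!exprMn.
rewrite ler_pXn2r ?nnegrE ?mulr_ge0 ?exprn_ge0 // expr2 -mulrA.
by rewrite ler_pM2l.
Qed.

Lemma wot_cvg (F : set_system (H -> H)) {FF : Filter F} (T : H -> H) :
  (forall x y, (fun S : H -> H => dot (S x) y) @ F --> dot (T x) y) ->
  (F : set_system (wot dot)) --> (T : wot dot).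
Proof.
move=> h.
have cv : matrix_coefficients dot @ F --> matrix_coefficients dot T.
  by apply/pointwise_cvgP => -[x y]; exact: h.
move=> A /= [_ [[B Bop <-] Bf sBA]].
have /cv : nbhs (matrix_coefficients dot T) B by rewrite nbhsE; exists B.
by move=> FB; exact: (filterS sBA FB).
Qed.

Lemma wot_cvg_strong (F : set_system (H -> H)) {FF : Filter F} (T : H -> H) :
  (forall x, (fun S : H -> H => S x) @ F --> T x) ->
  (F : set_system (wot dot)) --> (T : wot dot).
Proof.
move=> h; apply: wot_cvg => x y; apply/cvgrPdist_lt => e e0.
have y0 : 0 < 1 + `|y| by rewrite ltr_wpDr.
have /cvgrPdist_lt/(_ (e / (1 + `|y|))) := h x.
rewrite divr_gt0 // => /(_ isT); apply: filterS => S.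
rewrite ltr_pdivlMr // => hS; rewrite -linearBl.
apply: le_lt_trans (norm_dot _ _) _; apply: le_lt_trans hS.
by rewrite ler_wpM2l // lerDr.
Qed.

(** * Monotone limits and minimal elements in a von Neumann algebra *)

Section Algebra.
Variable M : set (wot dot).
Hypothesis Mvna : von_neumann_algebra M.

Lemma Mlin T : M T -> linear T.
Proof. by move=> /(vna_bounded Mvna)[]. Qed.

Lemma Mcont T : M T -> continuous T.
Proof. by move=> /(vna_bounded Mvna)[]. Qed.

Lemma Mbound T : M T ->
  exists2 K : R, 1 <= K & forall v, ip (T v) (T v) <= K ^+ 2 * ip v v.
Proof.
move=> MT; have /bounded_operatorP := vna_bounded Mvna MT.
move=> /(_ (Mlin MT))[K K0 hK]; exists (1 + K); first by rewrite lerDl.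
move=> v; apply: (le_trans (hK v)); rewrite ler_wpM2r ?ip_ge0 //.
by rewrite ler_pXn2r ?nnegrE ?addr_ge0 // lerDr.
Qed.

Lemma Mform_bound T : M T ->
  exists2 K : R, 1 <= K & forall v, `|ip (T v) v| <= K * ip v v.
Proof.
move=> /Mbound[K K1 hK]; exists K => // v.
have K0 : 0 <= K by apply: le_trans K1.
rewrite -(@ler_pXn2r _ 2) ?nnegrE ?mulr_ge0 ?ip_ge0 //.
rewrite real_normK ?num_real //; apply: le_trans (ip_CS _ _) _.
by rewrite exprMn [ip v v ^+ 2]expr2 mulrA ler_wpM2r ?ip_ge0.
Qed.

Lemma Mrscale t T : M T -> M (fun x => t *:r T x).
Proof. exact: vna_scale. Qed.

Lemma Mid : M (fun x => x). Proof. exact: vna_id. Qed.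

Lemma Madd S T : M S -> M T -> M (fun x => S x + T x).
Proof. exact: vna_add. Qed.

Lemma Mcomp S T : M S -> M T -> M (fun x => S (T x)).
Proof. exact: vna_comp. Qed.

Lemma Msub S T : M S -> M T -> M (fun x => S x - T x).
Proof.
move=> MS MT; have := Madd MS (vna_scale Mvna (-1) MT).
by congr M; apply/funext => x; rewrite scaleN1r.
Qed.

(** [F] plays the role of the decreasing net [C] indexed by itself. *)
Definition net_limit (C : set (H -> H)) (F : set_system (H -> H))
    (T : H -> H) :=
  [/\ ProperFilter F, F C, forall S, C S -> F [set S' | le_op S' S] &
      forall v, (fun S : H -> H => S v) @ F --> T v].

(** Monotone convergence.  Along a decreasing chain the numbers [ip (S v) v]
    are Cauchy, and [pos_bound] converts this into [S v] being Cauchy in [H].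
    The limit is a strong, hence weak, limit of elements of [M], so it lies in
    [M] as soon as it is bounded. *)
Lemma chain_limit (C : set (H -> H)) :
  C !=set0 -> C `<=` M -> C `<=` positive -> total_on C le_op ->
  exists T F, [/\ M T, positive T & net_limit C F T].
Proof.
move=> [S0 CS0] CM Cpos Ctot.
pose F := filter_from C (fun S => C `&` [set S' | le_op S' S]).
have leT S1 S2 S3 : le_op S1 S2 -> le_op S2 S3 -> le_op S1 S3.
  by move=> h1 h2 v; apply: le_trans (h1 v) (h2 v).
have FF : ProperFilter F.
  apply: filter_from_proper => [|S CS]; last by exists S; split=> // v.
  apply: filter_from_filter; first by exists S0.
  move=> S1 S2 C1 C2; have [h|h] := Ctot _ _ C1 C2.
    by exists S1 => // S [CS SS1]; split; split=> //=; exact: leT h.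
  by exists S2 => // S [CS SS2]; split; split=> //=; exact: leT h.
have FC : F C by exists S0 => // S [].
have Fle S : C S -> F [set S' | le_op S' S] by move=> CS; exists S => // S' [].
have [K K1 hK] := Mform_bound (CM _ CS0).
have K0 : 0 < K by apply: lt_le_trans K1.
have Fcvg v : cvg ((fun S : H -> H => S v) @ F).
  apply/cauchy_cvgP/cauchy_exP => _ /gt0_realC[e e0 ->].
  pose E := [set ip (S v) v | S in C].
  have hE : has_inf E.
    split; first by exists (ip (S0 v) v), S0.
    by exists 0 => _ [S /Cpos[_ _ p] <-].
  have e2K : 0 < e ^+ 2 / K by rewrite divr_gt0 // exprn_gt0.
  have [_ [S1 C1 <-] hS1] := inf_adherent e2K hE.
  (* S2 is also taken below S0 so that the bound K of S0 serves for S2 - S *)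
  have [S2 [C2 S20 S21]] : exists S2, [/\ C S2, le_op S2 S0 & le_op S2 S1].
    have [h|h] := Ctot _ _ C1 CS0.
      by exists S1; split=> // v.
    by exists S0; split=> // v.
  exists (S2 v), S2 => // S [CS SS2] /=.
  rewrite -ball_normE /= normlt_ip //.
  have [l2 s2 p2] := Cpos _ C2; have [l s p] := Cpos _ CS.
  have pD : positive (fun v => S2 v - S v).
    split=> [a x y|x y|x]; last by rewrite ipBl subr_ge0.
      by rewrite l2 l scalerBr opprD addrACA.
    by rewrite ipBl ipBr s s2.
  have D0 w : ip (S2 w - S w) w <= K * ip w w.
    rewrite ipBl; have := hK w; rewrite ler_norml => /andP[_].
    have := S20 w; have := p w; lra.
  apply: le_lt_trans (pos_bound pD (ltW K0) D0 v) _.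
  rewrite ipBl mulrC -ltr_pdivlMr //.
  have : inf E <= ip (S v) v by apply: inf_lbound; [case: hE|exists S].
  have := S21 v; lra.
pose T v := lim ((fun S : H -> H => S v) @ F).
have cT v : (fun S : H -> H => S v) @ F --> T v by exact: Fcvg.
have lT : linear T.
  move=> a x y; apply: (cvg_eq _ (cT _) (cvgD (cvgZr (cT x)) (cT y))).
  by apply: filterS FC => S /Cpos[l _ _]; exact: l.
have pT : positive T.
  split=> // [x y|x]; last first.
    apply: (cvgr_to_ge (cvg_ip (cT x))).
    by apply: filterS FC => S /Cpos[_ _]; exact.
  have h1 : (fun S : H -> H => ip (S x) y) @ F --> ip (T x) y by exact: cvg_ip.
  have h2 : (fun S : H -> H => ip (S y) x) @ F --> ip (T y) x by exact: cvg_ip.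
  rewrite [RHS]ipC; apply: (cvg_unique (@norm_hausdorff _ R^o) h1).
  apply: cvg_trans h2; apply: near_eq_cvg; apply: filterS FC => S /Cpos[_ s _].
  by rewrite s ipC.
exists T, F; split=> //; apply: (vna_closed Mvna); split.
  rewrite closureEcvg; exists F => //; split; first exact: wot_cvg_strong.
  by move=> A MA; apply: filterS FC => S /CM; exact: MA.
apply/bounded_operatorP => //; exists K; first exact: ltW.
move=> v; rewrite expr2 -mulrA.
have TS0 w : ip (T w) w <= K * ip w w.
  apply: (cvgr_to_le (cvg_ip (cT w))).
  apply: filterS (Fle _ CS0) => S SS0; apply: (le_trans (SS0 w)).
  by have := hK w; rewrite ler_norml => /andP[].
apply: le_trans (pos_bound pT (ltW K0) TS0 v) _.
by rewrite ler_pM2l.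
Qed.

Section NetLimit.
Variables (C : set (H -> H)) (F : set_system (H -> H)) (T : H -> H).
Hypothesis CFT : net_limit C F T.

Lemma net_limit_le S : C S -> le_op T S.
Proof.
case: CFT => FF FC Fle cT CS v; apply: (cvgr_to_le (cvg_ip (cT v))).
by apply: filterS (Fle _ CS) => S'; exact.
Qed.

Lemma net_limit_ge b : (forall S, C S -> le_op b S) -> le_op b T.
Proof.
case: CFT => FF FC Fle cT h v; apply: (cvgr_to_ge (cvg_ip (cT v))).
by apply: filterS FC => S /h; exact.
Qed.

Lemma net_limit_value v w : (forall S, C S -> S v = w) -> T v = w.
Proof.
case: CFT => FF FC Fle cT h; apply: (cvg_eq _ (cT v) (cvg_cst w)).
by apply: filterS FC => S /h.
Qed.

Lemma net_limit_comm y : continuous y ->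
  (forall S, C S -> forall v, y (S v) = S (y v)) ->
  forall v, y (T v) = T (y v).
Proof.
case: CFT => FF FC Fle cT cy h v.
have c : (fun S : H -> H => y (S v)) @ F --> y (T v).
  by apply: continuous_cvg; [exact: cy|exact: cT].
by apply: (cvg_eq _ c (cT _)); apply: filterS FC => S /h.
Qed.

End NetLimit.

(** Zorn's lemma in the form used throughout: [chain_limit] provides the lower
    bounds, so the closure of [X] under limits of chains is all that has to be
    checked in each application. *)
Lemma minimal_element (X : set (H -> H)) :
  X !=set0 -> X `<=` M -> X `<=` positive ->
  (forall C F T, C `<=` X -> C !=set0 -> net_limit C F T ->
    M T -> positive T -> X T) ->
  exists2 T, X T & forall S, X S -> le_op S T -> S = T.
Proof.
move=> [S0 XS0] XM Xpos Xlim.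
pose Rx (s t : {S | X S}) := `[< le_op (sval t) (sval s) >].
have [||||[T XT] hT] := @Zorn _ Rx.
- by move=> t; apply/asboolP => v.
- move=> r s t /asboolP rs /asboolP st; apply/asboolP => v.
  exact: le_trans (st v) (rs v).
- move=> [s Xs] [t Xt] /asboolP/= st /asboolP/= ts.
  have [ls ss _] := Xpos _ Xs; have [lt st' _] := Xpos _ Xt.
  by apply: eq_exist; exact: le_op_anti.
- move=> A Atot; have [[[S XS] AS]|nA] := pselect (A !=set0); last first.
    by exists (exist _ S0 XS0) => s As; case: nA; exists s.
  pose C := [set sval s | s in A].
  have CX : C `<=` X by move=> _ [[s Xs] _ <-].
  have C0 : C !=set0 by exists S, (exist _ S XS).
  have Ctot : total_on C le_op.
    move=> _ _ [s As <-] [t At <-]; have := Atot _ _ As At.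
    by move=> []/asboolP; [right|left].
  have [T [F [MT pT limT]]] :=
    chain_limit C0 (fun s Cs => XM _ (CX _ Cs))
      (fun s Cs => Xpos _ (CX _ Cs)) Ctot.
  exists (exist _ T (Xlim _ _ _ CX C0 limT MT pT)) => s As.
  by apply/asboolP; apply: (net_limit_le limT); exists s.
exists T => // S XS ST.
have := hT (exist _ S XS); rewrite /Rx /= => /(_ (asboolT ST)).
by move=> /(congr1 sval).
Qed.

(** * Spectral projections *)

(** Membership in the bicommutant of [b] relative to [M]: it makes everything
    constructed from [b] commute together, and with any [u] commuting with
    [b]. *)
Definition bicomm (b x : H -> H) := forall y, M y ->
  (forall v, y (b v) = b (y v)) -> forall v, y (x v) = x (y v).

Lemma net_limit_bicomm b C F T : net_limit C F T ->
  (forall S, C S -> bicomm b S) -> bicomm b T.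
Proof.
move=> lim h y My yb; apply: (net_limit_comm lim (Mcont My)) => S CS.
exact: (h _ CS _ My yb).
Qed.

Lemma pos_sub_bound D (K : R) v : positive D -> 0 <= K ->
  (forall w, ip (D w) w <= K * ip w w) ->
  ip (D v) (D v) <= K ^+ 2 * ip v v.
Proof.
move=> pD K0 hK; apply: le_trans (pos_bound pD K0 hK v) _.
by rewrite expr2 -mulrA ler_wpM2l.
Qed.

(** The decomposition [b = b_+ - b_-] with [b_- b_+ = 0].  Take [p] minimal
    among the majorants of [0] and [b], and [q = p - b].  The perturbation
    [p - d p q q p] is still such a majorant for small [d] because
    [p q q p] is dominated by multiples of both [p] and [q]; minimality forces
    [p q q p = 0], that is [q p = 0]. *)
Lemma pos_parts b : M b -> selfadjoint b -> exists p q,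
  [/\ M p /\ M q, positive p /\ positive q, bicomm b p /\ bicomm b q,
      forall v, b v = p v - q v & forall v, q (p v) = 0].
Proof.
move=> Mb sb.
pose X := [set x | [/\ M x, positive x, le_op b x & bicomm b x]].
have [|||C F T CX _ lim MT pT|p [Mp pp bp cp] pmin] := @minimal_element X.
- have [K K1 hK] := Mform_bound Mb.
  have MK := Mrscale K Mid.
  exists (fun x => K *:r x); split=> //.
  + split; first exact: Mlin.
      by move=> x y; rewrite ipZl ipZr.
    move=> x; rewrite ipZl mulr_ge0 ?ip_ge0 //; lra.
  + by move=> v; rewrite ipZl; have := hK v; rewrite ler_norml => /andP[].
  + by move=> y My _ v; rewrite (linZr _ _ (Mlin My)).
- by move=> x [].
- by move=> x [].
- split=> //; first by apply: (net_limit_ge lim) => S /CX[].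
  by apply: (net_limit_bicomm lim) => S /CX[].
pose q v := p v - b v.
have Mq : M q by exact: Msub.
have [lp sp p0] := pp.
have pq : positive q.
  split; first exact: Mlin.
    by move=> x y; rewrite ipBl ipBr sp sb.
  by move=> x; rewrite ipBl subr_ge0.
have [lq sq q0] := pq.
have cq : bicomm b q.
  by move=> y My yb v; rewrite (linB _ _ (Mlin My)) yb (cp _ My yb).
have pqC v : p (q v) = q (p v).
  by rewrite (cq _ Mp) // => w; rewrite (cp _ Mb).
exists p, q; split=> // v; first by rewrite /q opprB addrC subrK.
have [Kp Kp1 hKp] := Mform_bound Mp; have [Kq Kq1 hKq] := Mform_bound Mq.
pose K := Kp + Kq.
have K0 : 0 < K by rewrite /K; lra.
have bnd Kx x (h : forall v, `|ip (x v) v| <= Kx * ip v v) : Kx <= K ->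
    forall v, ip (x v) v <= K * ip v v.
  move=> KxK w; have := h w; rewrite ler_norml => /andP[_ /le_trans]; apply.
  by rewrite ler_wpM2r ?ip_ge0.
have bp' := bnd _ _ hKp (ltac:(rewrite /K; lra)).
have bq' := bnd _ _ hKq (ltac:(rewrite /K; lra)).
(* s = p q q p = q p p q, whence a bound by p and a bound by q *)
pose s v := p (q (q (p v))).
have sE w : ip (s w) w = ip (q (p w)) (q (p w)) by rewrite sp sq.
have sp' w : ip (s w) w <= K ^+ 3 * ip (p w) w.
  rewrite sE; apply: le_trans (pos_sub_bound _ pq (ltW K0) bq') _.
  rewrite [K ^+ 3]exprSr -mulrA ler_wpM2l ?exprn_ge0 ?(ltW K0) //.
  exact: (pos_bound pp (ltW K0) bp').
have sq' w : ip (s w) w <= K ^+ 3 * ip (q w) w.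
  rewrite sE -pqC; apply: le_trans (pos_sub_bound _ pp (ltW K0) bp') _.
  rewrite [K ^+ 3]exprSr -mulrA ler_wpM2l ?exprn_ge0 ?(ltW K0) //.
  exact: (pos_bound pq (ltW K0) bq').
pose d := (K ^+ 3)^-1.
have d0 : 0 < d by rewrite invr_gt0 exprn_gt0.
have dE a c : a <= K ^+ 3 * c -> d * a <= c.
  by move=> h; rewrite ler_pdivrMl // exprn_gt0.
pose x' v := p v - d *:r s v.
have Ms : M s by do 3 apply: Mcomp => //.
have Mx' : M x' by apply: Msub => //; exact: Mrscale.
have xp : x' = p.
  apply: pmin; last first.
    by move=> w; rewrite ipBl ipZl gerBl mulr_ge0 ?(ltW d0) // sE ip_ge0.
  split=> //.
  - split; first exact: Mlin.
      move=> x y; rewrite ipBl ipBr ipZl ipZr sp; congr (_ - _ * _).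
      by rewrite /s sp sq sq sp.
    by move=> x; rewrite ipBl ipZl subr_ge0; exact: dE.
  - move=> w; rewrite ipBl ipZl lerBrDr -lerBrDl -ipBl; exact: dE.
  - move=> y My yb w; have ly := Mlin My.
    by rewrite (linB _ _ ly) (linZr _ _ ly) /s !(cp _ My yb, cq _ My yb).
have : ip (p v - x' v) v = 0 by rewrite xp subrr ip0l.
rewrite /x' opprB addrC subrK ipZl => /eqP; rewrite mulf_eq0 (gt_eqF d0) /=.
by rewrite sE => /eqP/ip_eq0.
Qed.

Definition Mproj (e : H -> H) :=
  [/\ M e, selfadjoint e & forall v, e (e v) = e v].

(** With [b = p - q] as above, take [g] minimal among the [y] with
    [0 <= y <= 1] and [y p = p].  Then [g ^ 2] is another such element below
    [g], so [g] is a projection; and so is [g - g q g / K], which forces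
    [q g = 0].  Thus [b] is [p] on the range of [g] and [- q] off it. *)
Lemma spectral_projection b : M b -> selfadjoint b -> exists g,
  [/\ Mproj g, bicomm b g, forall v, 0 <= ip (b (g v)) (g v) &
      forall v, g v = 0 -> ip (b v) v <= 0].
Proof.
move=> Mb sb; have [p [q [[Mp Mq] [pp pq] [cp cq] bE qp]]] := pos_parts Mb sb.
pose X := [set y | [/\ M y, positive y, le_op y (fun x => x), bicomm b y &
                      forall v, y (p v) = p v]].
have [|||C F T CX [S CS] lim MT pT|g [Mg pg g1 cg gp] gmin] :=
  @minimal_element X.
- exists (fun x => x); split=> //; first exact: Mid.
  + by split=> // v; exact: ip_ge0.
- by move=> y [].
- by move=> y [].
- split=> //.
  + move=> v; have [_ _ S1 _ _] := CX _ CS.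
    exact: le_trans (net_limit_le lim CS v) (S1 v).
  + by apply: (net_limit_bicomm lim) => S' /CX[].
  + by move=> v; apply: (net_limit_value lim) => S' /CX[].
have [lg sg g0] := pg; have [lq sq q0] := pq; have [lp sp p0] := pp.
have gg : (fun v => g (g v)) = g.
  apply: gmin => [|v]; last first.
    rewrite sg -[leRHS]mul1r; apply: (pos_bound pg) => // w.
    by rewrite mul1r; exact: g1.
  split.
  - exact: Mcomp.
  - split; first by apply: Mlin; exact: Mcomp.
      by move=> x y; rewrite !sg.
    by move=> x; rewrite sg ip_ge0.
  - move=> v; apply: le_trans (g1 v); rewrite sg -[leRHS]mul1r.
    by apply: (pos_bound pg) => // w; rewrite mul1r; exact: g1.
  - by move=> y My yb v; rewrite !(cg _ My yb).
  - by move=> v; rewrite !gp.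
have {}gg v : g (g v) = g v by rewrite -[in RHS]gg.
have [K K1 hK] := Mform_bound Mq.
have K0 : 0 < K by lra.
have bq v : ip (q v) v <= K * ip v v.
  by have := hK v; rewrite ler_norml => /andP[].
pose y v := g v - K^-1 *:r g (q (g v)).
have My : M y.
  by apply: Msub => //; apply: Mrscale; do 2 apply: Mcomp => //.
have yg : y = g.
  apply: gmin => [|v]; last first.
    by rewrite ipBl ipZl gerBl mulr_ge0 ?invr_ge0 ?(ltW K0) // sg.
  split=> //.
  - split; first exact: Mlin.
      by move=> v w; rewrite ipBl ipBr ipZl ipZr !sg sq sg.
    move=> v; rewrite ipBl ipZl subr_ge0 ler_pdivrMl // sg.
    have -> : ip (g v) v = ip (g v) (g v) by rewrite -[RHS]sg gg.
    exact: bq.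
  - move=> v; apply: le_trans (g1 v).
    by rewrite ipBl ipZl gerBl mulr_ge0 ?invr_ge0 ?(ltW K0) // sg.
  - move=> z Mz zb v; have lz := Mlin Mz.
    by rewrite (linB _ _ lz) (linZr _ _ lz) !(cg _ Mz zb, cq _ Mz zb).
  - move=> v; rewrite /y gp qp (lin0 lg) /rscale scaler0 subr0 //.
have qg v : q (g v) = 0.
  have : ip (g v - y v) v = 0 by rewrite yg subrr ip0l.
  rewrite /y opprB addrC subrK ipZl => /eqP.
  rewrite mulf_eq0 invr_eq0 (gt_eqF K0) /= sg => /eqP h.
  apply: ip_eq0; apply/eqP; rewrite eq_le ip_ge0 andbT.
  by apply: le_trans (pos_bound pq (ltW K0) bq (g v)) _; rewrite h mulr0.
exists g; split=> // v; first by rewrite bE qg subr0.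
move=> gv; rewrite bE ipBl.
have -> : p v = 0.
  rewrite -gp -(cg _ Mp) ?gv ?(lin0 lp) // => w.
  by rewrite (cp _ Mb).
by rewrite ip0l sub0r oppr_le0.
Qed.

Lemma ip_ext x y : (forall z, ip z x = ip z y) -> x = y.
Proof.
move=> h; apply/eqP; rewrite -subr_eq0; apply/eqP; apply: ip_eq0.
by rewrite ipBr h subrr.
Qed.

(** * Minimal projections are atoms *)

Definition im (x : H) : H := ('i%C : Cplx R) *: x.

Lemma im_im x : im (im x) = - x.
Proof. by rewrite /im scalerA -expr2 sqr_i scaleN1r. Qed.

Lemma ip_imE x y : ip (im x) y = - complex.Im (dot x y).
Proof. by rewrite /ip /im linearZl_LR Rei. Qed.

Lemma ip_im x y : ip (im x) y = - ip x (im y).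
Proof.
rewrite [ip x _]ipC !ip_imE (@hermitian_subproof _ _ _ _ dot x y).
by rewrite expr0 mul1r Im_conj.
Qed.

Lemma imB x y : im (x - y) = im x - im y. Proof. exact: scalerBr. Qed.

Lemma im_rscale t x : im (t *:r x) = t *:r im x.
Proof. by rewrite /im /rscale !scalerA mulrC. Qed.

Lemma linI (T : H -> H) x : linear T -> T (im x) = im (T x).
Proof. exact: linZ. Qed.

(** Real and imaginary parts of [x], with the adjoint [xs] of [x]: an operator
    commuting with [x] and [xs] commutes with both parts. *)
Lemma cartesian x : M x -> exists y z xs,
  [/\ (M y /\ M z) /\ M xs, selfadjoint y /\ selfadjoint z,
      forall v w, ip (x v) w = ip v (xs w),
      forall v, x v = y v + im (z v) &
      forall c, linear c -> (forall v, c (x v) = x (c v)) ->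
        (forall v, c (xs v) = xs (c v)) ->
        (forall v, c (y v) = y (c v)) /\ (forall v, c (z v) = z (c v))].
Proof.
move=> Mx; have [xs Mxs adj] := vna_adjoint Mvna Mx.
have ipx v w : ip (x v) w = ip v (xs w) by rewrite /ip adj.
have ipxs v w : ip (xs v) w = ip v (x w) by rewrite ipC -ipx ipC.
pose y v := 2^-1 *:r (x v + xs v).
pose z v := 2^-1 *:r im (xs v - x v).
exists y, z, xs; split=> //.
- split=> //; split; first by apply: Mrscale; exact: Madd.
  by apply: Mrscale; apply: (vna_scale Mvna); exact: Msub.
- split=> v w; rewrite ipZl ipZr; first by rewrite ipDl ipDr ipx ipxs addrC.
  rewrite ip_im ipBl !imB !ipBr ipx ipxs.
  by rewrite (linI _ (Mlin Mx)) (linI _ (Mlin Mxs)) opprB.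
- move=> v; rewrite /z im_rscale im_im opprB /y -rscaleDr addrACA subrr addr0.
  have -> : 2^-1 *:r (x v + x v) = (2^-1 + 2^-1) *:r x v.
    by rewrite rscaleDr rscaleDl.
  have -> : 2^-1 + 2^-1 = 1 :> R by field.
  by rewrite rscale1.
- move=> c lc cx cxs; split=> v; rewrite /y /z linZr //.
    by rewrite linD // cx cxs.
  by rewrite linI // linB // cx cxs.
Qed.

Lemma proj_form e v : Mproj e -> ip (e v) v = ip (e v) (e v).
Proof. by move=> [_ se ee]; rewrite -[RHS]se ee. Qed.

Lemma proj_defect e v : Mproj e ->
  ip (v - e v) (v - e v) = ip v v - ip (e v) v.
Proof.
move=> Me; rewrite !(ipBl, ipBr) -(proj_form _ Me) [ip v (e v)]ipC.
by rewrite subrr subr0.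
Qed.

Lemma proj_absorb e f : Mproj e -> Mproj f ->
  (forall v, e (f v) = f v) -> forall v, f (e v) = f v.
Proof.
move=> [_ se _] [_ sf _] ef v; apply: ip_ext => z.
by rewrite -sf -se ef sf.
Qed.

(** For projections the operator order is inclusion of ranges, since the
    squared distance from [v] to the range of [e] is [ip v v - ip (e v) v]. *)
Lemma proj_le_op e f : Mproj e -> Mproj f ->
  (forall v, e (f v) = f v) <-> le_op f e.
Proof.
move=> Me Mf; have [_ _ ff] := Mf; split=> [ef v|fe v].
  rewrite (proj_form _ Me) (proj_form _ Mf) -[f v](proj_absorb Me Mf ef).
  rewrite -(proj_form _ Mf) -subr_ge0 -(proj_defect _ Mf); exact: ip_ge0.
apply/esym/eqP; rewrite -subr_eq0; apply/eqP/ip_eq0; apply/eqP.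
rewrite eq_le ip_ge0 andbT (proj_defect _ Me) subr_le0.
by have := fe (f v); rewrite ff.
Qed.

Section MinimalProjection.
Variables (u e : H -> H).
Hypothesis Mu : M u.
Hypothesis Me : Mproj e.
Hypothesis eu : forall v, e (u v) = u (e v).
Hypothesis emin : forall f, Mproj f -> (forall v, f (u v) = u (f v)) ->
  (forall v, e (f v) = f v) ->
  (forall v, f v = 0) \/ (forall v, f v = e v).

(** The spectral projection of [b] commutes with [e] and [u], so it induces a
    projection below [e], which is [0] or [e]. *)
Lemma minimal_dichotomy b : M b -> selfadjoint b ->
  (forall v, e (b v) = b (e v)) -> (forall v, u (b v) = b (u v)) ->
  (forall v, 0 <= ip (b (e v)) (e v)) \/ (forall v, ip (b (e v)) (e v) <= 0).
Proof.
move=> Mb sb eb ub; have [g [[Mg sg gg] cg g0 g1]] := spectral_projection Mb sb.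
have [Me' se ee] := Me.
have eg v : e (g v) = g (e v) by exact: cg.
have [||| f0 | fe] := emin (f := fun v => g (e v)).
- split; first exact: Mcomp.
    by move=> x y; rewrite sg se eg.
  by move=> v; rewrite eg gg ee.
- by move=> v; rewrite eu (cg _ Mu ub).
- by move=> v; rewrite eg ee.
- by right=> v; exact: g1.
- by left=> v; have := g0 (e v); rewrite fe.
Qed.

(** By [minimal_dichotomy] every [a - t] has a constant sign on the range of
    [e]; the scalar is the largest [t] for which this sign is nonnegative. *)
Lemma minimal_scalar a : M a -> selfadjoint a -> (exists v, e v <> 0) ->
  (forall v, e (a v) = a (e v)) -> (forall v, u (a v) = a (u v)) ->
  exists t, forall v, a (e v) = t *:r e v.
Proof.
move=> Ma sa [v0 ev0] ea ua; have [Me' se ee] := Me.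
have [la le lu] := And3 (Mlin Ma) (Mlin Me') (Mlin Mu).
pose E := [set t : R | forall v, t * ip (e v) (e v) <= ip (a (e v)) (e v)].
have [K K1 hK] := Mform_bound Ma.
have n0 : 0 < ip (e v0) (e v0).
  rewrite lt_def ip_ge0 andbT; apply/eqP => /ip_eq0; exact: ev0.
have supE : has_sup E.
  split.
    exists (- K) => v /=; have := hK (e v); rewrite ler_norml => /andP[h _].
    by rewrite mulNr.
  exists K => t /(_ v0) /= h; have := hK (e v0); rewrite ler_norml => /andP[_].
  by move=> /(le_trans h); rewrite ler_pM2r.
pose t := sup E; exists t.
have tge v : t * ip (e v) (e v) <= ip (a (e v)) (e v).
  have := ip_ge0 (e v); rewrite [0 <= _]le_eqVlt => /orP[/eqP/esym|np].
    by move=> /ip_eq0 ->; rewrite (lin0 la) ip0l mulr0.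
  rewrite -ler_pdivlMr //; apply: sup_le_ub; first by case: supE.
  by move=> s; rewrite ler_pdivlMr //; exact.
have gtt s : t < s -> forall v, ip (a (e v)) (e v) <= s * ip (e v) (e v).
  move=> ts; pose b v := a v - s *:r v.
  have Mb : M b by apply: Msub => //; apply: Mrscale; exact: Mid.
  have bE v : ip (b v) v = ip (a v) v - s * ip v v by rewrite ipBl ipZl.
  have [|||h|h] := minimal_dichotomy Mb.
  - by move=> x y; rewrite ipBl ipBr ipZl ipZr sa.
  - by move=> v; rewrite /b (linB _ _ le) (linZr _ _ le) ea.
  - by move=> v; rewrite /b (linB _ _ lu) (linZr _ _ lu) ua.
  - have : E s by move=> v; have := h v; rewrite bE subr_ge0.
    by move=> /(sup_ubound supE.2); rewrite leNgt ts.
  - by move=> v; have := h v; rewrite bE subr_le0.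
have tle v : ip (a (e v)) (e v) <= t * ip (e v) (e v).
  have := ip_ge0 (e v); rewrite [0 <= _]le_eqVlt => /orP[/eqP/esym|np].
    by move=> /ip_eq0 ->; rewrite (lin0 la) ip0l mulr0.
  rewrite -ler_pdivrMr //; apply/ler_addgt0Pr => d d0.
  rewrite ler_pdivrMr //; apply: (gtt (t + d) _ v).
  by rewrite ltrDl.
have form w : ip (a (e w) - t *:r e w) w =
    ip (a (e w)) (e w) - t * ip (e w) (e w).
  by rewrite ipBl ipZl -!se ea !ee.
move=> v; apply/eqP; rewrite -subr_eq0; apply/eqP.
apply: (@pos0 (fun v => a (e v) - t *:r e v)) => [|w].
  split=> [|x y|w]; last by rewrite form subr_ge0.
    by apply: Mlin; apply: Msub; [exact: Mcomp|exact: Mrscale].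
  by rewrite ipBl ipBr ipZl ipZr -ea !se sa.
by apply/eqP; rewrite form subr_eq0 eq_le tle tge.
Qed.

(** Once [u] is known to be scalar on the range of [e], commuting with [u] is no
    longer a restriction on the operators [e y e]. *)
Lemma minimal_atom : (exists v, e v <> 0) -> unitary_operator dot u ->
  atom M e.
Proof.
move=> e0 [u' [adj uu' u'u]]; have [Me' se ee] := Me.
have [le lu] := conj (Mlin Me') (Mlin Mu).
have [h1 [h2 [us [[[M1 M2] Mus] [s1 s2] uus uE hc]]]] := cartesian Mu.
have usE v : us v = u' v.
  by apply: ip_ext => z; rewrite -uus /ip adj.
have usu v : us (u v) = v by rewrite usE; exact: (congr1 (@^~ v) uu').
have uus1 v : u (us v) = v by rewrite usE; exact: (congr1 (@^~ v) u'u).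
have eus v : e (us v) = us (e v).
  by apply: ip_ext => z; rewrite -se -uus -eu se uus.
have [eh1 eh2] := hc _ le eu eus.
have [uh1 uh2] : (forall v, u (h1 v) = h1 (u v)) /\
    (forall v, u (h2 v) = h2 (u v)).
  by apply: hc => // v; rewrite usu uus1.
have [t1 ht1] := minimal_scalar M1 s1 e0 eh1 uh1.
have [t2 ht2] := minimal_scalar M2 s2 e0 eh2 uh2.
pose lam : Cplx R := (t1%:C%C : Cplx R) + ('i%C : Cplx R) * (t2%:C%C : Cplx R).
have ue v : u (e v) = lam *: e v by rewrite uE ht1 ht2 scalerDl -scalerA.
have scal y : M y -> selfadjoint y ->
    exists t, forall v, e (y (e v)) = t *:r e v.
  move=> My sy; have ly := Mlin My.
  have [|||||t ht] := @minimal_scalar (fun v => e (y (e v))).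
  - by do 2 apply: Mcomp => //.
  - by move=> v w; rewrite se sy se.
  - exact: e0.
  - by move=> v; rewrite !ee.
  - by move=> v; rewrite ue eu ue (linZ _ _ ly) (linZ _ _ le).
  - by exists t => v; rewrite -ht ee.
split=> //.
- split; first by apply/funext.
  by apply/selfadjointP.
- by move=> h; case: e0 => v; rewrite h.
apply/seteqP; split=> f /= [x Mx <-].
  have [y [z [_ [[[My Mz] _] [sy sz] _ xE _]]]] := cartesian Mx.
  have [t ht] := scal _ My sy; have [s hs] := scal _ Mz sz.
  exists ((t%:C%C : Cplx R) + ('i%C : Cplx R) * (s%:C%C : Cplx R)) => //.
  apply/funext => v /=; rewrite xE (linD _ _ le) (linI _ le) ht hs.
  by rewrite scalerDl -scalerA.
exists (fun v => x *: v); first exact: (vna_scale Mvna x Mid).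
by apply/funext => v /=; rewrite (linZ _ _ le) ee.
Qed.

End MinimalProjection.

(** * Localizing a unitary to a projection *)

Lemma adjoint_ip S T : linear T ->
  (forall v w, ip (T v) w = ip v (S w)) -> is_adjoint dot T S.
Proof. by move=> lT h x y; rewrite !dot_ip /im -(linZ _ _ lT) !h. Qed.

Lemma unitary_isometry u : unitary_operator dot u ->
  forall v, ip (u v) (u v) = ip v v.
Proof.
move=> [u' [adj uu' _]] v.
by rewrite /ip adj (congr1 (@^~ v) uu' : u' (u v) = v).
Qed.

Definition localize (u e : H -> H) : H -> H := fun v => u (e v) + (v - e v).

Lemma unitary_group_comp u v : unitary_group M u -> unitary_group M v ->
  unitary_group M (fun x => u (v x)).
Proof.
move=> [Mu [u' [ua uu' u'u]]] [Mv [v' [va vv' v'v]]].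
split; first exact: Mcomp.
exists (fun x => v' (u' x)); split=> [x y||]; first by rewrite ua va.
- apply/funext => x /=; rewrite (congr1 (@^~ (v x)) uu' : u' (u (v x)) = v x).
  exact: (congr1 (@^~ x) vv').
- apply/funext => x /=.
  rewrite (congr1 (@^~ (u' x)) v'v : v (v' (u' x)) = u' x).
  exact: (congr1 (@^~ x) u'u).
Qed.

Section Localize.
Variable u : H -> H.
Hypothesis Uu : unitary_group M u.

Definition cproj (e : H -> H) := Mproj e /\ forall v, e (u v) = u (e v).

Lemma localize_unitary e : cproj e -> unitary_group M (localize u e).
Proof.
move=> [[Me se ee] eu]; case: Uu => Mu [u' [adj uu' u'u]].
have [le lu] := conj (Mlin Me) (Mlin Mu).
have Mw : M (localize u e).
  by apply: Madd; [exact: Mcomp|apply: Msub => //; exact: Mid].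
split=> //.
have ipu v w : ip (u v) w = ip v (u' w) by rewrite /ip adj.
have u'uE v : u' (u v) = v by exact: (congr1 (@^~ v) uu').
have uu'E v : u (u' v) = v by exact: (congr1 (@^~ v) u'u).
have eu' v : e (u' v) = u' (e v).
  by apply: ip_ext => z; rewrite -se -!ipu -eu se.
have u'D v w : u' (v + w) = u' v + u' w.
  by apply: ip_ext => z; rewrite ipDr -!ipu ipDr.
have eD v : e (v - e v) = 0 by rewrite linB // ee subrr.
exists (fun v => u' (e v) + (v - e v)); split.
- apply: adjoint_ip; first exact: Mlin.
  by move=> v w; rewrite /localize !(ipDl, ipDr, ipNl, ipNr) ipu !se eu'.
- apply/funext => v /=; rewrite /localize (linD _ _ le) eD addr0 eu ee u'uE.
  by rewrite [_ - u (e v)]addrC addKr addrC subrK.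
- apply/funext => v /=; rewrite /localize (linD _ _ le) eD addr0 eu' ee uu'E.
  by rewrite [_ - u' (e v)]addrC addKr addrC subrK.
Qed.

Lemma localize_commute e v : cproj e ->
  e (localize u e v) = localize u e (e v).
Proof.
move=> [[Me se ee] eu]; have le := Mlin Me.
by rewrite /localize (linD _ _ le) (linB _ _ le) eu ee subrr.
Qed.

Lemma localize_out e v : cproj e -> e v = 0 -> localize u e v = v.
Proof.
move=> [[Me se ee] eu] ev; rewrite /localize ev subr0 (lin0 (Mlin Uu.1)).
by rewrite add0r.
Qed.

Lemma cproj_sub e f : cproj e -> cproj f -> (forall v, e (f v) = f v) ->
  cproj (fun v => e v - f v).
Proof.
move=> [Me0 eu] [Mf0 fu] ef; have [Me se ee] := Me0; have [Mf sf ff] := Mf0.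
have [[le lf] lu] := conj (conj (Mlin Me) (Mlin Mf)) (Mlin Uu.1).
have fe v : f (e v) = f v.
  by apply: ip_ext => z; rewrite -sf -se ef sf.
split; last by move=> v; rewrite (linB _ _ lu) eu fu.
split; first exact: Msub.
  by move=> x y; rewrite ipBl ipBr se sf.
by move=> v; rewrite (linB _ _ le) (linB _ _ lf) ee ef fe ff subrr subr0.
Qed.

Lemma localize_sub e f : cproj e -> cproj f -> (forall v, e (f v) = f v) ->
  localize u e =
  (fun v => localize u f (localize u (fun w => e w - f w) v)).
Proof.
move=> [Me0 eu] [Mf0 fu] ef; have [Me se ee] := Me0; have [Mf sf ff] := Mf0.
have [[le lf] lu] := conj (conj (Mlin Me) (Mlin Mf)) (Mlin Uu.1).
have fe v : f (e v) = f v.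
  by apply: ip_ext => z; rewrite -sf -se ef sf.
apply/funext => v.
have fz : f (localize u (fun w => e w - f w) v) = f v.
  rewrite /localize (linD _ _ lf) fu !(linB _ _ lf) fe ff subrr (lin0 lu).
  by rewrite add0r subr0.
rewrite [in RHS]/localize fz /localize (linB _ _ lu).
by rewrite opprB !addrA [u (f v) + _]addrC addrK [RHS]addrAC addrK.
Qed.

End Localize.

(** * Triviality of continuous finite-dimensional representations *)

Section Representation.
Variables (n : nat) (pi : wot dot -> 'M[Cplx R]_n).
Hypothesis pirep :
  @unitary_representation R (wot dot) (fun u v : H -> H => u \o v) idfun
    (unitary_group M) n pi.
Hypothesis picont : {within unitary_group M, continuous pi}.

Lemma unitary_id : unitary_group M idfun.
Proof. by split; [exact: Mid|exists idfun]. Qed.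

(** Unlike [localize u p] itself, this property is visibly stable under
    composition, hence passes to powers. *)
Definition supported (p T : H -> H) :=
  (forall v, p (T v) = T (p v)) /\ (forall v, p v = 0 -> T v = v).

(** Uniformity over all unitaries supported on a small projection is what makes
    the absence of small subgroups applicable.  The sets [B (s, e)] below
    generate a filter converging weakly to the identity, since for [T]
    supported on [p] one has [dot (T x - x) y = dot (T (p x) - p x) (p y)], of
    modulus at most [2 |p x| |p y|]; so some [B (s, e)] lies in the
    neighbourhood of the identity given by the continuity of [pi]. *)
Lemma continuity_at_id : exists (s : seq H) (e : R), 0 < e /\
  forall p T, Mproj p -> unitary_group M T -> supported p T ->
    (forall x, x \in s -> ip (p x) (p x) < e) ->
    mxsum (pi T - 1%:M) <= 2^-1.
Proof.
(* n ^ 2 entries, each within d, have sum at most 1 / 2 *)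
pose d : R := (2 * (1 + n%:R * n%:R))^-1.
have nn : 0 <= n%:R * n%:R :> R by rewrite mulr_ge0.
have d0 : 0 < d by rewrite invr_gt0; lra.
have near1 : \forall T \near (idfun : wot dot),
    unitary_group M T -> mxsum (pi T - 1%:M) <= 2^-1.
  have /subspace_continuousP/(_ _ unitary_id) cid := picont.
  have dC : 0 < (d%:C%C : Cplx R) by rewrite ltcR.
  have hn : nbhs (idfun : wot dot) [set T | unitary_group M T ->
      ball (pi idfun) (d%:C%C : Cplx R) (pi T)].
    exact: (cid _ (nbhsx_ballx (pi idfun) _ dC)).
  apply: filterS hn => T h UT; have {h} := h UT.
  rewrite (rep_one pirep) => h.
  apply: (@le_trans _ _ (n%:R * (n%:R * d))).
    apply: mxsum_near1 => [|i j]; first exact: ltW.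
    have := h.2 i j; rewrite -ball_normE /= distrC absrE ltcR !mxE.
    exact: ltW.
  by rewrite mulrA ler_pdivrMr; lra.
pose B (i : seq H * R) : set (H -> H) := [set T | exists p,
  [/\ Mproj p, unitary_group M T, supported p T &
      forall x, x \in i.1 -> ip (p x) (p x) < i.2]].
pose D := [set i : seq H * R | 0 < i.2].
pose F := filter_from D B.
have FF : Filter F.
  apply: filter_from_filter; first by exists ([::], 1); rewrite /D /=.
  move=> [s e] [s' e'] /= e0 e0'; exists (s ++ s', Num.min e e').
    by rewrite /D /= lt_min e0 e0'.
  by move=> T [p [Mp UT pT h]]; split; exists p; split=> // x xs;
    have := h x; rewrite /= mem_cat xs ?orbT lt_min => /(_ isT)/andP[].
have Fid : (F : set_system (wot dot)) --> (idfun : wot dot).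
  apply: wot_cvg => x y; apply/cvgrPdistC_lt => _ /gt0_realC[e e0 ->].
  pose m : R := Num.min 1 (e / 4).
  have m0 : 0 < m by rewrite lt_min ltr01 divr_gt0.
  exists ([:: x; y], m ^+ 2); first by rewrite /D /= exprn_gt0.
  move=> T [p [[Mp sp pp] UT [pT Tout] h]] /=.
  have [lp lT] := conj (Mlin Mp) (Mlin UT.1).
  have px : `|p x| < (m%:C%C : Cplx R).
    by rewrite normlt_ip //; apply: h; rewrite !inE eqxx.
  have py : `|p y| < (m%:C%C : Cplx R).
    by rewrite normlt_ip //; apply: h; rewrite !inE eqxx orbT.
  have Tx : T x - x = p (T (p x) - p x).
    rewrite linB // pT !pp; have := Tout (x - p x).
    rewrite linB // pp subrr => /(_ erefl); rewrite linB // => h'.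
    by rewrite -[T x](subrK (T (p x))) h' addrAC [x - _]addrC addrK addrC.
  have adj : is_adjoint dot p p by apply/selfadjointP.
  have -> : dot (T x) y - dot x y = dot (T (p x) - p x) (p y).
    by rewrite -adj -Tx linearBl.
  apply: le_lt_trans (norm_dot _ _) _.
  have nT : `|T (p x)| = `|p x|.
    apply/eqP; rewrite -(@eqrXn2 _ 2) //.
    by rewrite !ip_norm (unitary_isometry UT.2).
  have h1 : `|T (p x) - p x| <= ((m + m)%:C%C : Cplx R).
    apply: le_trans (ler_normB _ _) _; rewrite nT rmorphD /=.
    by apply: lerD; exact: ltW.
  have h2 : ((m + m)%:C%C * m%:C%C : Cplx R) < e%:C%C.
    rewrite -rmorphM ltcR.
    have m1 : m <= 1 by rewrite ge_min lexx.
    have me : m <= e / 4 by rewrite ge_min lexx orbT.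
    nra.
  by apply: le_lt_trans h2; apply: ler_pM => //; exact: ltW.
have [[s e] /= e0 hB] := Fid _ near1.
exists s, e; split=> // p T Mp UT pT h.
by apply: hB => //; exists p.
Qed.

Lemma rep_comp T S : unitary_group M T -> unitary_group M S ->
  pi (fun v => T (S v)) = pi T *m pi S.
Proof. by move=> UT US; rewrite -(rep_mul pirep UT US). Qed.

(** If [T] is supported on [p] then so is [T ^ 2]; each squaring multiplies the
    distance of [pi T] to [1] by at least [3 / 2] ([mxsum_sqr]), while
    [continuity_at_id] keeps it below [1 / 2]. *)
Lemma small_projection_trivial u : unitary_group M u ->
  exists (s : seq H) (e : R), 0 < e /\
  forall p, cproj u p -> (forall x, x \in s -> ip (p x) (p x) < e) ->
    pi (localize u p) = 1%:M.
Proof.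
move=> Uu; have [s [e [e0 hs]]] := continuity_at_id.
exists s, e; split=> // p cp psmall; have [Mp pu] := cp.
apply/eqP; rewrite -subr_eq0; apply/eqP/mxsum_eq0.
apply: (@geometric_bounded0 _ _ 2^-1); first exact: mxsum_ge0.
suff grow m T : unitary_group M T -> supported p T ->
    (3 / 2) ^+ m * mxsum (pi T - 1%:M) <= 2^-1.
  move=> m; apply: grow; first exact: localize_unitary.
  by split=> v; [exact: localize_commute|exact: localize_out].
elim: m T => [|m IH] T UT [pT Tout].
  by rewrite expr0 mul1r; apply: (hs p).
have U2 := unitary_group_comp UT UT.
have S2 : supported p (fun v => T (T v)).
  by split=> v; [rewrite !pT|move=> pv; rewrite !Tout].
have := IH _ U2 S2; rewrite rep_comp //; apply: le_trans.
rewrite exprSr -mulrA ler_wpM2l ?exprn_ge0 //; apply: mxsum_sqr.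
by apply: (hs p).
Qed.

(** The set [X] below consists of the visible projections; that it is closed
    under limits [T] of chains holds because some [S] in the chain has
    [S - T] small, and then [localize u S] and [localize u T] have the same
    image. *)
Lemma rep_trivial (Mdiff : diffuse M) u : unitary_group M u -> pi u = 1%:M.
Proof.
move=> Uu; have lu := Mlin Uu.1; apply: contrapT => piu.
pose X := [set e | cproj u e /\ pi (localize u e) <> 1%:M].
have Xpos : X `<=` positive.
  move=> e [[[Me se ee] _] _]; split=> // [|v]; first exact: Mlin.
  by rewrite -ee se ip_ge0.
have loc0 e : (forall v, e v = 0) -> pi (localize u e) = 1%:M.
  move=> e0; rewrite -(rep_one pirep); congr pi; apply/funext => v.
  by rewrite /localize e0 subr0 (lin0 lu) add0r.
have split_trivial e f : cproj u e -> cproj u f -> (forall v, e (f v) = f v) ->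
    pi (localize u f) = 1%:M ->
    pi (localize u (fun v => e v - f v)) = 1%:M -> pi (localize u e) = 1%:M.
  move=> ce cf ef h1 h2; rewrite (localize_sub Uu ce cf ef) rep_comp.
  - by rewrite h1 h2 mulmx1.
  - exact: localize_unitary.
  - by apply: localize_unitary => //; exact: cproj_sub.
have [|||C F T CX _ lim MT pT|e [ce pie] emin] := @minimal_element X.
- exists (fun v => v); split.
    by split=> //; split=> //; exact: Mid.
  move=> h; apply: piu; rewrite -h; congr pi; apply/funext => v.
  by rewrite /localize subrr addr0.
- by move=> e [[[]]].
- exact: Xpos.
- have [lT sT pT0] := pT.
  have ST S : C S -> forall v, S (T v) = T v.
    move=> CS v; have [FF FC Fle cvgT] := lim; have [MpS _] := (CX _ CS).1.
    have cS : (fun S' : H -> H => S (S' v)) @ F --> S (T v).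
      by apply: continuous_cvg; [apply: Mcont; case: MpS|exact: cvgT].
    apply: (cvg_eq _ cS (cvgT v)); apply: filterS2 FC (Fle _ CS) => S' CS' S'S.
    by move: v {cS}; apply/(proj_le_op MpS (CX _ CS').1.1).
  have TT v : T (T v) = T v.
    by apply: (net_limit_value lim) => S CS; exact: ST.
  have cT : cproj u T.
    split=> // v; symmetry; apply: (net_limit_comm lim) => [|S /CX[[_ uS] _] w].
      exact: (Mcont Uu.1).
    by rewrite uS.
  split=> // piT.
  have [s [e [e0 hs]]] := small_projection_trivial Uu.
  have [FF FC _ cvgT] := lim.
  have near_s : F [set S | forall x, x \in s -> ip (T x - S x) (T x - S x) < e].
    elim: s {hs} => [|x s IH]; first by apply: filterS FC.
    have /cvg_ipP/(_ e e0) := cvgT x.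
    move=> hx; apply: filterS2 hx IH => S hSx hSs y.
    by rewrite inE => /orP[/eqP ->|/hSs].
  have [S [CS Ss]] := filter_ex (filterI FC near_s).
  have [cS piS] := CX _ CS; apply: piS.
  apply: (split_trivial _ T) => //; first exact: ST.
  apply: hs; first by apply: cproj_sub => //; exact: ST.
  by move=> x xs; have := Ss x xs; rewrite -opprB ipNl ipC ipNl opprK.
apply: (Mdiff e); have [Me eu] := ce; have [Me' se ee] := Me.
have le := Mlin Me'.
apply: (minimal_atom Uu.1 Me) => //.
- move=> f Mf fu ef; have cf : cproj u f by [].
  have cg := cproj_sub Uu ce cf ef; have [Mg _] := cg.
  have lt_e h : cproj u h -> (forall v, e (h v) = h v) ->
      pi (localize u h) <> 1%:M -> h = e.
    by move=> ch eh pih; apply: emin => //; apply/(proj_le_op Me ch.1).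
  have [h|h] := pselect (pi (localize u f) = 1%:M); last first.
    by right=> v; rewrite (lt_e f).
  left=> v; have eg : (fun v => e v - f v) = e.
    apply: lt_e => // [w|piG]; first by rewrite linB // ee ef.
    by apply: pie; exact: (split_trivial _ f).
  have := congr1 (@^~ v) eg => /= /eqP; rewrite subr_eq addrC -subr_eq subrr.
  by move=> /eqP.
- apply: contrapT => e0; apply: pie; apply: loc0 => v.
  by apply: contrapT => ev; apply: e0; exists v.
- exact: Uu.2.
Qed.

End Representation.
End Algebra.
End InnerProduct.

(** Every line is invariant. *)
Lemma irreducible_trivial_dim1 (R : realType) (G : topologicalType)
    (U : set G) (n : nat) (pi : G -> 'M[Cplx R]_n) :
  (forall u, U u -> pi u = 1%:M) -> irreducible_representation U pi -> n = 1%N.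
Proof.
move=> pi1 [n0 irr]; case: n n0 pi pi1 irr => // n _ pi pi1 irr.
pose w : 'cV[Cplx R]_n.+1 := delta_mx 0 0.
have w0 : w != 0.
  apply/eqP => /matrixP/(_ 0 0); rewrite !mxE !eqxx /= => /eqP.
  by rewrite oner_eq0.
have dimw : (\dim <[w]>%VS = 1)%N.
  by rewrite dim_vline; exact: (congr1 nat_of_bool w0).
have [|/(congr1 (@dimv _ _))|/(congr1 (@dimv _ _))] := irr <[w]>%VS.
- by move=> u v Uu vW; rewrite pi1 // mul1mx.
- by rewrite dimw dimv0.
- by rewrite dimw dimvf /dim /= muln1 => <-.
Qed.

Theorem theorem1p6 (R : realType) (H : completeNormedModType (Cplx R))
    (dot : {dot H for @Num.conj (Cplx R)}) (Hhilb : is_hilbert dot)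
    (Hsep : separable_space H) (M : set (wot dot))
    (Mvna : von_neumann_algebra M) (Mdiff : diffuse M) :
  @minimally_almost_periodic R (wot dot)
    (fun u v : H -> H => u \o v) idfun (unitary_group M).
Proof.
move=> n pi pirep picont piirr.
have pi1 u : unitary_group M u -> pi u = 1%:M.
  exact: (rep_trivial Hhilb Mvna pirep picont Mdiff).
by split=> //; exact: irreducible_trivial_dim1 piirr.
Qed.
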